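(* Let $K$ be a field, $S=K[t_1,\ldots,t_s]$, and let $D$ be a weighted oriented graph with vertex set $V(D)=\{t_1,\ldots,t_s\}$ in which every source has weight $1$, with underlying graph $G$, edge ideal $I(D)$, and dual $J(D)$ of $I(D)$. If $I(D)$ has no embedded primes, then the following conditions are equivalent: (a) $\mathrm{Ass}(J(D)^n)\subset\mathrm{Ass}(J(D))$ for all $n\geq 1$; (b) $J(D)^n=J(D)^{(n)}$ for all $n\geq 1$; (c) $I(D)^n=I(D)^{(n)}$ for all $n\geq 1$; (d) every vertex in $V^+(D)$ is a sink and $G$ is bipartite.
   Context: A weighted oriented graph $D=(V(D),E(D),w)$ with underlying simple graph $G$ (vertex set $V(G)=V(D)=\{t_1,\ldots,t_s\}$) is given by a choice of exactly one direction for each edge of $G$ (so $E(D)\subset V(D)\times V(D)$, $|E(D)|=|E(G)|$, and $E(G)$ is the set of pairs $\{t_i,t_j\}$ with $(t_i,t_j)\in E(D)$), together with a weight function $w\colon V(D)\to\{1,2,\ldots\}$; write $w_i=w(t_i)$. An edge $(t_i,t_j)$ is directed from $t_i$ to $t_j$. A source is a vertex with only outgoing edges; a sink is a vertex with only incoming edges. $V^+(D)$ is the set of vertices $t_i$ with $w_i>1$. The edge ideal of $D$ is $I(D):=(\{t_it_j^{w_j}\mid (t_i,t_j)\in E(D)\})$ and its dual is $J(D):=\bigcap_{(t_i,t_j)\in E(D)}(t_i,t_j^{w_j})$. $\mathrm{Ass}(I)$ is the set of associated primes of an ideal $I\subset S$, i.e. primes of the form $(I\colon f)$, $f\in S$;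 an embedded prime is an associated prime properly containing another associated prime; $\mathrm{minAss}(I)$ is the set of inclusion-minimal elements of $\mathrm{Ass}(I)$. For $n\geq 1$, the $n$-th symbolic power is $I^{(n)}:=\bigcap_{\mathfrak{p}\in\mathrm{minAss}(I)}(I^nS_{\mathfrak{p}}\cap S)$. *)

(* Defs.v *)
From HB Require Import structures.
From mathcomp Require Import all_boot all_order all_algebra.
From mathcomp Require Import mpoly.

Set Implicit Arguments.
Unset Strict Implicit.
Unset Printing Implicit Defensive.

Import GRing.Theory.
Local Open Scope ring_scope.

(* Ideals are Prop-valued predicates, since membership in an arbitrary ideal is
   not decidable; equality of ideals is therefore extensional. *)

Section Ideals.
Variable R : comNzRingType.
Implicit Types (I J P Q A : R -> Prop) (f g : R).

Definition is_ideal I : Prop :=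
  [/\ I 0, (forall f g, I f -> I g -> I (f + g))
    & (forall f g, I g -> I (f * g))].

Definition ideal_sub I J : Prop := forall f, I f -> J f.
Definition ideal_eq I J : Prop := forall f, I f <-> J f.

Definition ideal_gen A : R -> Prop :=
  fun f => forall I, is_ideal I -> (forall a, A a -> I a) -> I f.

Definition ideal_mul I J : R -> Prop :=
  ideal_gen (fun h => exists f g, [/\ I f, J g & h = f * g]).

Definition ideal_pow I (n : nat) : R -> Prop :=
  iter n (ideal_mul I) (fun _ => True).

Definition ideal_colon I f : R -> Prop := fun g => I (g * f).

Definition is_prime_ideal P : Prop :=
  [/\ is_ideal P, ~ P 1 & forall f g, P (f * g) -> P f \/ P g].

Definition Ass I P : Prop :=
  is_prime_ideal P /\ exists f, ideal_eq P (ideal_colon I f).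

Definition minAss I P : Prop :=
  Ass I P /\ forall Q, Ass I Q -> ideal_sub Q P -> ideal_eq Q P.

Definition embedded_prime I P : Prop :=
  Ass I P /\ exists Q, [/\ Ass I Q, ideal_sub Q P & ~ ideal_sub P Q].

End Ideals.

Section Localization.
Variable R : idomainType.
Implicit Types (I P : R -> Prop) (x y z : {fraction R}).

(* The localization of R at P, as a subring of the field of fractions. *)
Definition loc_ring P x : Prop :=
  exists a u : R, ~ P u /\ x = tofrac a / tofrac u.

(* The ideal of [loc_ring P] generated by the image of I. *)
Definition loc_ext P I x : Prop :=
  forall M : {fraction R} -> Prop,
    M 0 ->
    (forall y z, M y -> M z -> M (y + z)) ->
    (forall y z, loc_ring P y -> M z -> M (y * z)) ->
    (forall a, I a -> M (tofrac a)) ->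
    M x.

Definition symbolic_power I (n : nat) : R -> Prop :=
  fun f => forall P, minAss I P -> loc_ext P (ideal_pow I n) (tofrac f).

End Localization.

(* The asymmetry of [arc] says that the underlying graph is simple (no loops)
   and that each of its edges carries exactly one direction. *)
Record wograph (s : nat) := WOGraph {
  arc : rel 'I_s;
  weight : 'I_s -> nat;
  arc_asym : forall i j, arc i j -> ~~ arc j i;
  weight_gt0 : forall i, (0 < weight i)%N
}.

Section WeightedOrientedGraphs.
Variables (s : nat) (D : wograph s).

Definition underlying : rel 'I_s := fun i j => arc D i j || arc D j i.

Definition is_source (i : 'I_s) : Prop := forall j, ~~ arc D j i.
Definition is_sink (i : 'I_s) : Prop := forall j, ~~ arc D i j.

Definition in_Vplus (i : 'I_s) : Prop := (1 < weight D i)%N.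

End WeightedOrientedGraphs.

Definition bipartite (T : finType) (e : rel T) : Prop :=
  exists c : T -> bool, forall x y, e x y -> c x != c y.

Section EdgeIdeals.
Variables (K : fieldType) (s : nat) (D : wograph s).

Definition edge_ideal : {mpoly K[s]} -> Prop :=
  ideal_gen (fun f => exists i j, arc D i j /\ f = 'X_i * 'X_j ^+ weight D j).

Definition dual_ideal : {mpoly K[s]} -> Prop :=
  fun f => forall i j, arc D i j ->
    ideal_gen (fun g => g = 'X_i \/ g = 'X_j ^+ weight D j) f.

End EdgeIdeals.

Arguments edge_ideal K {s} D _.
Arguments dual_ideal K {s} D _.

(* Main.v *)
Require Import Defs.
From HB Require Import structures.
From mathcomp Require Import all_boot all_order all_algebra.
From mathcomp Require Import mpoly zify.
From Stdlib Require Import Classical FunctionalExtensionality PropExtensionality.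
(* The later imports shadow the arcs of a weighted oriented graph by the arcs
   of a cyclic sequence; this restores the former. *)
Import Defs.

(** All four conditions are statements about exponent vectors.

    A monomial ideal consists of the polynomials whose monomials have their
    exponents in a fixed up-closed set [A] ([monI A]), and its powers correspond
    to the sumsets of [A].  A minimal prime of [monI A] is generated by a set [C]
    of variables that is minimal among the sets meeting the support of each
    exponent of [A] ([minAss_monI]).  Localizing there makes the variables outside
    [C] invertible, that is, it raises their exponents to a large value
    ([monI_locP]; the key is [monI_sat], a primary decomposition in disguise).  So
    [ideal_pow] agrees with [symbolic_power] if and only if an exponent that lies
    in the [n]-th sumset after each such raising lies in it already
    ([pow_symbolicP]).

    For [J] the sets [C] are the pairs of ends of an arc, and equality of the
    [n]-th powers says: if [n <= m_i + floor (m_j / w_j)] for every arc [(i, j)],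
    then [m] is a sum of [n] exponents of [J] ([dual_pow_symbolicP]).  For [I] the
    sets [C] are the minimal vertex covers of the graph.

    - (a) => (b): the associated primes of [J] are all minimal.  An exponent that
      lies in the symbolic power but not in the power yields an associated prime
      of the power at which the two localizations differ, which is impossible
      when this prime is minimal over [J] ([Ass_pow_symbolic]).
    - (b) => (d) only uses squares.  If [j] is heavy on a path [i -> j -> k],
      then an exponent with entries [1] at [i], [w_j] at [j], and a suitably chosen
      entry at [k] is in the symbolic square but not a sum of two exponents of [J]
      ([cover_no_through]).  Once the heavy vertices are sinks, the weight vector
      itself is in the symbolic square, and writing it as a sum of two exponents of
      [J] is the same as two-colouring the graph ([cover_bipartite]).
    - (c) => (d): on a path as above, [t_i t_j^w_j t_k^w_k] is in the symbolic
      square of [I] but not in the square ([edge_sinks]).  When the heavy vertices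
      are sinks, a closed walk of length [2k+1] gives a monomial of weighted degree
      [2k+1], hence outside [I^(k+1)]; each vertex cover meets the walk at least
      [k+1] times, so the monomial is in the symbolic power ([edge_bipartite]).
    - (d) => (a): in a bipartite graph an explicit chain of covers shows that
      [J^n] is the intersection of the ideals [(t_i, t_j^w_j)^n]
      ([bipartite_cover_pow]), each of which is primary ([Ass_cap]).
    - (d) => (c): on exponents this is the capacitated form of the theorem of
      Koenig and Egervary ([konig]).

    The remaining implication (b) => (c) goes through (d). *)

Set Implicit Arguments.
Unset Strict Implicit.
Unset Printing Implicit Defensive.

Import GRing.Theory.

(** * Two-colourings and matchings of bipartite graphs *)

Section Coloring.
Variables (T : finType) (e : rel T).
Hypothesis sym_e : forall x y, e x y = e y x.

(** The walks in the double cover of the graph record the parity of their length.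
    Without closed walks of odd length, each vertex is reached from the root of
    its component with only one parity, and this parity is a colouring. *)
Lemma bipartite_no_odd_cycle :
  (forall x p, path e x p -> last x p = x -> ~~ odd (size p)) -> bipartite e.
Proof.
move=> even_e.
pose d (u v : T * bool) := e u.1 v.1 && (u.2 != v.2).
have sym_d u v : d u v = d v u by rewrite /d sym_e eq_sym.
have symc : connect_sym d := sym_connect_sym sym_d.
have proj q u : path d u q ->
    path e u.1 (map fst q) /\ (last u q).2 = u.2 (+) odd (size q).
  elim: q u => [|v q IHq] u /=; first by rewrite addbF.
  case/andP => /andP[euv nuv] /IHq[-> ->]; rewrite euv; split=> //.
  by move: nuv; case: (u.2); case: (v.2); case: odd.
have lift p x b : path e x p -> connect d (x, b) (last x p, b (+) odd (size p)).
  elim: p x b => [|y p IHp] x b /=; first by rewrite addbF connect0.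
  case/andP => exy /IHp yp; apply: (connect_trans (y := (y, ~~ b))).
    by apply: connect1; rewrite /d /= exy; case: (b).
  by have := yp (~~ b); rewrite addNb addbN.
have nflip x : ~~ connect d (x, false) (x, true).
  apply/negP => /connectP[q dq lastq]; have [eq lq] := proj _ _ dq.
  have := even_e _ _ eq; rewrite last_map -lastq size_map => /(_ erefl).
  by move: lq; rewrite -lastq /= => <-.
pose r := fingraph.root e; exists (fun x => connect d (r x, false) (x, true)) => x y exy.
have <- : r x = r y.
  by apply/eqP; rewrite (root_connect (sym_connect_sym sym_e)) connect1.
have exyb b : connect d (x, b) (y, ~~ b) by apply: connect1; rewrite /d /= exy; case: (b).
have [rx|nrx] := boolP (connect d (r x, false) (x, true)).
  rewrite eq_sym eqb_id; apply: contra (nflip y) => ry.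
  by rewrite (connect_trans _ ry) // symc (connect_trans rx) // (exyb true).
rewrite eq_sym eqbF_neg negbK; have /connectP[p ep lastp] : connect e (r x) x.
  by rewrite (sym_connect_sym sym_e) connect_root.
have := lift p _ false ep; rewrite -lastp addFb.
case: odd => [rx|/connect_trans]; [by rewrite rx in nrx | by apply; apply: exyb].
Qed.

(** Each of the [size p] steps of the walk has an end in [C], and a vertex of the
    closed walk is an end of two steps. *)
Lemma cover_closed_walk (C : {set T}) x p :
  (forall u v, e u v -> (u \in C) || (v \in C)) ->
  path e x p -> last x p = x -> size p <= (count [pred x in C] p).*2.
Proof.
move=> covC ep lastp.
(* The ends of an open walk count once; this form is stable under induction. *)
suff: forall x, path e x p -> (size p + (last x p \in C) <= (x \in C) + (count [pred x in C] p).*2)%N.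
  by move=> /(_ _ ep); rewrite lastp; lia.
elim: p {x ep lastp} => [|y p IHp] x //=; first by rewrite addn0.
by case/andP => /covC xy /IHp; move: xy; do 2 case: (_ \in C) => //=; lia.
Qed.

End Coloring.

Section Konig.
Variables (T : finType) (e : rel T) (c : T -> bool).
Hypothesis col_e : forall x y, e x y -> c x != c y.
Implicit Types (C : {set T}) (a : T -> nat).

Definition vcover C := [forall x, forall y, e x y ==> (x \in C) || (y \in C)].

Lemma vcoverP C : reflect (forall x y, e x y -> (x \in C) || (y \in C)) (vcover C).
Proof.
apply: (iffP forallP) => [covC x y | covC x]; first by move/forallP/(_ y)/implyP: (covC x).
by apply/forallP => y; apply/implyP; apply: covC.
Qed.

Lemma sum_eq_in C x : (\sum_(v in C) (v == x) = (x \in C))%N.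
Proof.
have [xC|xC] := boolP (x \in C).
  by rewrite (big_setD1 x) //= eqxx big1 // => v; rewrite !inE => /andP[/negPf-> _].
by rewrite big1 // => v vC; case: eqP vC xC => // -> ->.
Qed.

(** The hard half of the weighted theorem of Koenig and Egervary, which says that
    the minimal capacity of a vertex cover is the largest size of a family of edges
    using each vertex within its capacity.  The proof lowers the capacities.  Let [x] be a vertex of the
    first colour class of positive capacity.  If no cover of capacity exactly [n]
    contains [x], lower the capacity of [x].  Otherwise the covers of capacity [n]
    that contain [x] are closed under the lattice operation that intersects the
    first colour class and unites the second, so one of them, [C0], has a largest
    part in the second class.  By minimality of its capacity, [C0] misses some
    neighbour [y] of [x] of positive capacity; then no cover of capacity [n]
    contains both [x] and [y], and the edge between them can be selected. *)
Lemma konig a n : (forall C, vcover C -> n <= \sum_(v in C) a v) ->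
  exists E : seq (T * T), [/\ size E = n, all (fun p => e p.1 p.2) E
    & forall v, \sum_(p <- E) ((p.1 == v) + (p.2 == v)) <= a v].
Proof.
have [d] := ubnP (\sum_v a v); elim: d a n => // d IHd a n lt_d cov_a.
have sumT (f : T -> nat) : \sum_(v in setT) f v = \sum_v f v.
  by apply: eq_bigl => v; rewrite in_setT.
case: n cov_a => [_|n cov_a]; first by exists [::]; split=> // v; rewrite big_nil.
have covA : vcover [set v | c v].
  by apply/vcoverP => x y /col_e; rewrite !inE; case: (c x); case: (c y).
have [x cx ax] : exists2 x, c x & 0 < a x.
  apply: NNPP => none; have := cov_a _ covA; rewrite big1 // => x; rewrite inE => cx.
  by apply/eqP; rewrite -leqn0 leqNgt; apply/negP => ax; apply: none; exists x.
pose tight C := [&& vcover C, x \in C & \sum_(v in C) a v == n.+1].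
have [C1 tC1|ntight] := pickP tight; last first.
  pose a' v := a v - (v == x).
  have aE v : a v = a' v + (v == x) by rewrite /a'; case: eqP => [->|] /=; lia.
  have sumE C : \sum_(v in C) a v = \sum_(v in C) a' v + (x \in C).
    by rewrite -sum_eq_in -big_split; apply: eq_bigr => v _; apply: aE.
  have [||E [szE eE aE']] := IHd a' n.+1.
  - by move: lt_d (sumE setT); rewrite in_setT !sumT /=; clear; lia.
  - move=> C covC; have := ntight C; rewrite /tight covC /=; move: (cov_a C covC).
    by rewrite sumE; case: (x \in C) => /=; lia.
  by exists E; split=> // v; apply: leq_trans (aE' v) _; rewrite aE leq_addr.
pose B := [set v | ~~ c v].
have [C0 tC0 maxC0] := @arg_maxnP _ C1 tight (fun C => #|C :&: B|) tC1.
have [/vcoverP covC0 xC0 /eqP sC0] := and3P tC0.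
have [y [exy ay yC0]] : exists y, [/\ e x y || e y x, 0 < a y & y \notin C0].
  apply: NNPP => none.
  (* Otherwise x could be replaced in C0 by vertices of capacity zero. *)
  pose C := (C0 :\ x) :|: [set v | a v == 0].
  have covC : vcover C.
    have nbr z : e x z || e z x -> z \in C.
      move=> exz; rewrite !inE; have [az|az] := eqVneq (a z) 0; rewrite ?orbT // orbF.
      apply/andP; split; first by case: eqP exz => // ->; case/orP => /col_e; rewrite eqxx.
      apply/negPn/negP => zC0; apply: none; exists z; split=> //; by rewrite lt0n.
    apply/vcoverP => u v euv; have [ux|ux] := eqVneq u x.
      by rewrite (nbr v) ?orbT // -ux euv.
    have [vx|vx] := eqVneq v x; first by rewrite (nbr u) // -vx euv orbT.
    by have := covC0 u v euv; rewrite !inE ux vx /=; do 2 case: (_ \in C0); rewrite ?orbT.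
  have := cov_a C covC; rewrite leqNgt => /negP; apply.
  have : \sum_(v in C) a v <= \sum_(v in C0 :\ x) a v.
    rewrite big_mkcond [leqRHS]big_mkcond; apply: leq_sum => v _.
    by rewrite !inE; have [->|_] := eqVneq (a v) 0; rewrite ?if_same ?orbF.
  move/leq_ltn_trans; apply; by rewrite -sC0 [ltnRHS](big_setD1 x) //= -[ltnLHS]add0n ltn_add2r.
have cy : c y = false.
  by case/orP: exy => /col_e; rewrite cx; case: (c y).
have ytight C : tight C -> y \notin C.
  case/and3P => /vcoverP covC xC /eqP sC; apply/negP => yC.
  (* Capacity is modular for these two operations, so M is tight as well, and a
     y in C would make the second part of M larger than that of C0. *)
  pose M := [set v | if c v then (v \in C) && (v \in C0) else (v \in C) || (v \in C0)].
  pose N := [set v | if c v then (v \in C) || (v \in C0) else (v \in C) && (v \in C0)].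
  have sMN : \sum_(v in M) a v + \sum_(v in N) a v = n.+1 + n.+1.
    rewrite -{1}sC -sC0 !(big_mkcond (fun v => v \in _)) -!big_split /=.
    by apply: eq_bigr => v _; rewrite !inE; case: (c v); case: (v \in C); case: (v \in C0); rewrite //= ?addn0.
  have covM : vcover M.
    apply/vcoverP => u v euv; move: (covC _ _ euv) (covC0 _ _ euv) (col_e euv).
    rewrite !inE; case: (c u); case: (c v) => // + + _;
    by case: (u \in C); case: (v \in C); case: (u \in C0); case: (v \in C0).
  have covN : vcover N.
    apply/vcoverP => u v euv; move: (covC _ _ euv) (covC0 _ _ euv) (col_e euv).
    rewrite !inE; case: (c u); case: (c v) => // + + _;
    by case: (u \in C); case: (v \in C); case: (u \in C0); case: (v \in C0).
  have tM : tight M.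
    have xM : x \in M by rewrite inE cx xC xC0.
    rewrite /tight covM xM /=; move: sMN (cov_a _ covM) (cov_a _ covN).
    move: (\sum_(v in M) _) (\sum_(v in N) _) => p q; clear; lia.
  have /= := maxC0 _ tM; rewrite leqNgt => /negP; apply; apply: proper_card.
  apply/properP; split.
    by apply/subsetP => v; rewrite !inE; case: (c v); case: (v \in C); case: (v \in C0).
  by exists y; rewrite !inE cy ?yC ?(negPf yC0).
have xy : x != y by apply: contraFneq cy => <-.
pose a' v := a v - (v == x) - (v == y).
have aE v : a v = a' v + (v == x) + (v == y).
  rewrite /a'; have [->|_] := eqVneq v x; first by rewrite (negPf xy); move: ax; clear; lia.
  by have [->|_] := eqVneq v y; move: ay; clear; lia.
have sumE C : \sum_(v in C) a v = \sum_(v in C) a' v + (x \in C) + (y \in C).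
  by rewrite -!sum_eq_in -!big_split; apply: eq_bigr => v _; apply: aE.
have [||E [szE eE aE']] := IHd a' n.
- by move: lt_d (sumE setT); rewrite !in_setT !sumT /=; clear; lia.
- move=> C covC; have : (x \in C) && (y \in C) -> \sum_(v in C) a v != n.+1.
    case/andP=> xC; apply: contraL => /eqP sC; apply: ytight.
    by rewrite /tight covC xC sC /=.
  move: (cov_a C covC); rewrite sumE.
  move: (x \in C) (y \in C) (\sum_(v in C) _) => [] [] S; clear => /= leS H;
    try have := H isT; lia.
exists ((if e x y then (x, y) else (y, x)) :: E); split=> [|/=|v]; first by rewrite /= szE.
  by rewrite eE andbT; case: ifP exy.
rewrite big_cons (aE v) -[leqRHS]addnA [leqRHS]addnC leq_add ?aE' //.
by rewrite [v == x]eq_sym [v == y]eq_sym; case: ifP => _ //=; rewrite addnC.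
Qed.

End Konig.

(** * Up-closed sets of exponents *)

Section Exponents.
Variable s : nat.
Implicit Types (A B : 'X_{1..s} -> Prop) (C V : {set 'I_s}) (m : 'X_{1..s}).

Definition upclosed A : Prop := forall m m', (m <= m')%MM -> A m -> A m'.

Fixpoint sumset A n : 'X_{1..s} -> Prop :=
  if n is n'.+1 then fun m => exists a b, [/\ A a, sumset A n' b & m = (a + b)%MM]
  else fun _ => True.

Lemma sumset_up A n : upclosed A -> upclosed (sumset A n).
Proof.
case: n => [//|n] upA m m' mm' [a [b [Aa Ab mE]]].
exists (m' - m + a)%MM, b; split=> //; first by apply: upA Aa; apply: lem_addl.
by rewrite -addmA -mE submK.
Qed.

Lemma sumset_add A n a b m : upclosed A -> A a -> sumset A n b -> (a + b <= m)%MM ->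
  sumset A n.+1 m.
Proof. by move=> upA Aa Ab abm; apply: (@sumset_up A n.+1 upA _ _ abm); exists a, b. Qed.

Lemma sumset_split2 A m : sumset A 2 m -> exists a b, [/\ A a, A b & (a + b <= m)%MM].
Proof.
case=> a [_ [Aa [b [c [Ab _ ->]]] ->]]; exists a, b; split=> //.
by rewrite addmA; apply: lem_addr.
Qed.

Lemma sumset_pair A a b m : upclosed A -> A a -> A b -> (a + b <= m)%MM -> sumset A 2 m.
Proof.
move=> upA Aa Ab; apply: sumset_add => //.
by apply: (sumset_add (b := 0%MM) upA Ab) => //; rewrite addm0 lepm_refl.
Qed.

(** With a large [N] this is the exponent seen after the variables outside [C] have
    been inverted; with [N = 0] it is the projection to the variables of [C]. *)
Definition fill C N m : 'X_{1..s} := [multinom if i \in C then m i else N | i < s].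

Lemma fillE C N m i : fill C N m i = if i \in C then m i else N.
Proof. exact: mnmE. Qed.

(** Membership in [B] only depends on the variables of [V], once [B] is up-closed. *)
Definition supported V B : Prop := forall m, B m -> B (fill V 0 m).

Definition cap N m : 'X_{1..s} := [multinom minn (m i) N | i < s].

Lemma capE N m i : cap N m i = minn (m i) N.
Proof. exact: mnmE. Qed.

(** For an up-closed set this says that its minimal elements have entries at most
    [N], a finite generation in disguise. *)
Definition bounded N A : Prop := forall m, A m -> A (cap N m).

Lemma sumset_bounded N A n : upclosed A -> bounded N A -> bounded (n * N) (sumset A n).
Proof.
move=> upA bA; elim: n => [//|n IHn] m [a [b [Aa Ab ->]]].
have: (cap N a + cap (n * N) b <= cap (n.+1 * N) (a + b))%MM.
  apply/mnm_lepP => i; rewrite mnmDE !capE mnmDE mulSn; lia.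
move/(sumset_up (n := n.+1) upA); apply.
by exists (cap N a), (cap (n * N) b); split; [apply: bA | apply: IHn |].
Qed.

Definition hits C A : Prop := forall m, A m -> exists2 i, i \in C & m i != 0%N.

Definition minhits C A : Prop :=
  hits C A /\ forall C' : {set 'I_s}, C' \subset C -> hits C' A -> C' = C.

Lemma minhits_exists C A : hits C A -> exists2 C' : {set 'I_s}, C' \subset C & minhits C' A.
Proof.
have [d] := ubnP #|C|; elim: d C => // d IHd C lt_d hC.
have [[C' [sC' hC' neC]]|none] :=
    classic (exists C' : {set 'I_s}, [/\ C' \subset C, hits C' A & C' <> C]).
  have [|C'' sC'' mC''] := IHd C' _ hC'.
    apply: leq_trans (_ : #|C| <= d)%N; last by rewrite -ltnS.
    by apply: proper_card; rewrite properEneq sC' andbT; apply/eqP.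
  by exists C'' => //; apply: subset_trans sC'.
exists C => //; split=> // C' sC' hC'; apply: NNPP => neC.
by apply: none; exists C'.
Qed.

End Exponents.

(** * Ideals and localization *)

Section GeneralIdeals.
Variable R : comNzRingType.
Local Open Scope ring_scope.
Implicit Types I J P : R -> Prop.

Lemma ideal_eqP I J : ideal_eq I J -> I = J.
Proof.
by move=> eqIJ; apply: functional_extensionality => f; apply: propositional_extensionality.
Qed.

Lemma ideal_gen_ideal (A : R -> Prop) : is_ideal (ideal_gen A).
Proof.
split=> [I [I0 _ _] _ // | f g If Ig I idI AI | f g Ig I idI AI].
  by have [_ ID _] := idI; apply: ID; [apply: If | apply: Ig].
by have [_ _ IM] := idI; apply: IM; apply: Ig.
Qed.

Lemma ideal_gen_sub (A I : R -> Prop) :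
  is_ideal I -> (forall a, A a -> I a) -> ideal_sub (ideal_gen A) I.
Proof. by move=> idI AI f; apply. Qed.

Lemma ideal_gen_mem (A : R -> Prop) a : A a -> ideal_gen A a.
Proof. by move=> Aa I _; apply. Qed.

Lemma ideal_sum I (T : Type) (r : seq T) (p : pred T) (F : T -> R) :
  is_ideal I -> (forall x, p x -> I (F x)) -> I (\sum_(x <- r | p x) F x).
Proof. by case=> I0 ID _ IF; elim/big_ind: _. Qed.

Lemma ideal_sum_seq I (T : eqType) (r : seq T) (F : T -> R) :
  is_ideal I -> (forall x, x \in r -> I (F x)) -> I (\sum_(x <- r) F x).
Proof. by move=> idI IF; rewrite big_seq; apply: ideal_sum. Qed.

Lemma prime_pow P f n : is_prime_ideal P -> P (f ^+ n) -> P f.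
Proof.
case=> _ P1 PM; elim: n => [|n IHn]; first by rewrite expr0.
by rewrite exprS => /PM[//|/IHn].
Qed.

End GeneralIdeals.

Section LocalizedIdeals.
Variable R : idomainType.
Local Open Scope ring_scope.
Implicit Types I P : R -> Prop.

Lemma loc_extP P I f : is_prime_ideal P -> is_ideal I ->
  loc_ext P I (tofrac f) <-> exists2 u, ~ P u & I (u * f).
Proof.
move=> [[P0 _ _] P1 PM] [I0 ID IM].
have nzP u : ~ P u -> tofrac u != 0 :> {fraction R}.
  by move=> Pu; rewrite tofrac_eq0; apply/eqP => u0; apply: Pu; rewrite u0.
have PMn u v : ~ P u -> ~ P v -> ~ P (u * v) by move=> Pu Pv /PM[].
split=> [|[u Pu Iuf] M _ _ MM MI]; last first.
  have ->: tofrac f = (tofrac 1 / tofrac u) * tofrac (u * f) :> {fraction R}.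
    by rewrite tofrac1 tofracM mul1r mulKf ?nzP.
  by apply: MM (MI _ Iuf); exists 1, u.
(* The fractions a / u with a in I already form the extended ideal. *)
pose M (x : {fraction R}) := exists a u, [/\ I a, ~ P u & x = tofrac a / tofrac u].
move=> locf; suff: M (tofrac f).
  case=> a [u [Ia Pu fE]]; exists u => //; rewrite (_ : u * f = a) //.
  by apply/eqP; rewrite -tofrac_eq tofracM fE mulrC divfK ?nzP.
apply: locf; rewrite /M {M}.
- by exists 0, 1; split; rewrite // tofrac0 mul0r.
- move=> _ _ [a [u [Ia Pu ->]]] [b [v [Ib Pv ->]]].
  exists (a * v + b * u), (u * v); split; last 1 first.
  - by rewrite addf_div ?nzP // -!tofracM -tofracD.
  - by apply: ID; rewrite mulrC; apply: IM.
  exact: PMn.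
- move=> _ _ [a [u [Pu ->]]] [b [v [Ib Pv ->]]].
  exists (a * b), (u * v); split; [exact: IM | exact: PMn |].
  by rewrite mulf_div -!tofracM.
- by move=> a Ia; exists a, 1; split; rewrite // tofrac1 divr1.
Qed.

End LocalizedIdeals.

(** * Monomial ideals *)

Section MonomialIdeals.
Variables (K : fieldType) (s : nat).
Local Open Scope ring_scope.
Implicit Types (A B : 'X_{1..s} -> Prop) (C V : {set 'I_s}).
Implicit Types (m : 'X_{1..s}) (f g u : {mpoly K[s]}).

Definition monI A : {mpoly K[s]} -> Prop := fun f => forall m, m \in msupp f -> A m.

Lemma monIX A m : monI A 'X_[m] <-> A m.
Proof. by split=> [|Am k]; [apply; rewrite msuppX mem_head | rewrite msuppX inE => /eqP->]. Qed.

Lemma monI_ideal A : upclosed A -> is_ideal (monI A).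
Proof.
move=> upA; split=> [m | f g If Ig m | f g Ig m].
- by rewrite mcoeff_msupp mcoeff0 eqxx.
- by move/msuppD_le; rewrite mem_cat => /orP[/If|/Ig].
move/msuppM_le/allpairsP => [[a b] /= [_ b_g ->]].
by apply: upA (Ig _ b_g); apply: lem_addl.
Qed.

Lemma monI_terms (I : {mpoly K[s]} -> Prop) f :
  is_ideal I -> (forall m, m \in msupp f -> I 'X_[m]) -> I f.
Proof.
move=> idI If; rewrite (mpolyE f); apply: ideal_sum_seq => // m /If.
by case: idI => _ _ IM; rewrite -mul_mpolyC; apply: IM.
Qed.

Lemma monI_gen (T : Type) (P : T -> Prop) (g : T -> 'X_{1..s}) :
  ideal_gen (fun f => exists2 t, P t & f = 'X_[K, g t])
  = monI (fun m => exists2 t, P t & (g t <= m)%MM).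
Proof.
apply: ideal_eqP => f; split.
  apply: ideal_gen_sub => [|_ [t Pt ->]]; last by apply/monIX; exists t; rewrite ?lepm_refl.
  by apply: monI_ideal => m m' mm' [t Pt tm]; exists t => //; apply: lepm_trans mm'.
move=> If; apply: monI_terms => [|m /If[t Pt tm]]; first exact: ideal_gen_ideal.
have [_ _ IM] := ideal_gen_ideal (fun f => exists2 t, P t & f = 'X_[K, g t]).
by rewrite -(submK tm) mpolyXD; apply: IM; apply: ideal_gen_mem; exists t.
Qed.

Lemma monI_mul A B : upclosed A -> upclosed B ->
  ideal_mul (monI A) (monI B)
  = monI (fun m => exists a b, [/\ A a, B b & m = (a + b)%MM]).
Proof.
move=> upA upB; apply: ideal_eqP => f; split.
  apply: ideal_gen_sub => [|_ [g [h [Ag Bh ->]]] m].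
    apply: monI_ideal => m m' mm' [a [b [Aa Ab mE]]].
    exists (m' - m + a)%MM, b; split=> //; first by apply: upA Aa; apply: lem_addl.
    by rewrite -addmA -mE submK.
  move/msuppM_le/allpairsP => [[a b] /= [/Ag Aa /Bh Bb ->]]; by exists a, b.
move=> If; apply: monI_terms => [|_ /If[a [b [Aa Bb ->]]]]; first exact: ideal_gen_ideal.
rewrite mpolyXD; apply: ideal_gen_mem; exists 'X_[a], 'X_[b].
by split=> //; apply/monIX.
Qed.

Lemma monI_pow A n : upclosed A -> ideal_pow (monI A) n = monI (sumset A n).
Proof.
move=> upA; elim: n => [|n IHn]; first exact: ideal_eqP.
by rewrite /ideal_pow iterS -/(ideal_pow _ _) IHn monI_mul //; apply: sumset_up.
Qed.

Definition mfilter (p : pred 'X_{1..s}) f : {mpoly K[s]} :=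
  \sum_(m <- msupp f | p m) f@_m *: 'X_[m].

Lemma mcoeff_filter p f m : (mfilter p f)@_m = if p m then f@_m else 0.
Proof.
rewrite /mfilter raddf_sum /=.
have [m_f|] := boolP (m \in msupp f); last first.
  move=> m_f; rewrite (memN_msupp_eq0 m_f) if_same big_seq_cond big1 // => k /andP[k_f _].
  by rewrite mcoeffZ mcoeffX; case: eqVneq k_f m_f => [->->|]; rewrite ?mulr0.
rewrite big_mkcond (bigD1_seq m) ?msupp_uniq //= big1 ?addr0 => [|k /negPf km].
  by case: (p m) => //; rewrite mcoeffZ mcoeffX eqxx mulr1.
by case: (p k) => //; rewrite mcoeffZ mcoeffX km mulr0.
Qed.

(** The prime ideal generated by the variables of [V]. *)
Definition varI V := monI (fun m => exists2 i, i \in V & m i != 0%N).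

Lemma varI_fill V f : ~ varI V f -> exists2 m, m \in msupp f & fill V 0 m = 0%MM.
Proof.
move=> nVf; apply: NNPP => none; apply: nVf => m m_f; apply: NNPP => noi.
apply: none; exists m => //; apply/mnmP => i; rewrite fillE mnm0E.
by case: ifP => // iV; apply/eqP/negP => mi; apply: noi; exists i => //; apply/negP.
Qed.

(** An ideal generated by monomials in the variables of [V] stays saturated with
    respect to the polynomials outside [varI V].  Suppose that an exponent [m] of
    [f] is not in [B], with minimal degree in the variables of [V].  Then the
    part [f0] of [f] with the same projection to [V] as [m], multiplied by the
    part [u0] of [u] free of the variables of [V], is not cancelled by other terms
    of [u * f], so its leading exponent is in [B], hence [m] is. *)
Lemma monI_sat V B u f : upclosed B -> supported V B ->
  ~ varI V u -> monI B (u * f) -> monI B f.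
Proof.
move=> upB supB nVu Iuf.
pose vdeg m := mdeg (fill V 0 m).
suff: forall d m, (vdeg m < d)%N -> m \in msupp f -> B m by move=> + m; apply.
elim=> [//|d IHd] m lt_d m_f; apply: NNPP => nBm.
have fillD a b : fill V 0 (a + b)%MM = (fill V 0 a + fill V 0 b)%MM.
  by apply/mnmP => i; rewrite mnmDE !fillE mnmDE; case: ifP.
(* By induction on the degree, a smaller projection would be in B already. *)
have key k : k \in msupp f -> (fill V 0 k <= fill V 0 m)%MM -> fill V 0 k = fill V 0 m.
  move=> k_f le_k; apply: NNPP => ne_k; apply: nBm.
  apply: (upB (fill V 0 m)); first by apply/mnm_lepP => i; rewrite fillE; case: ifP.
  apply: (upB _ _ le_k); apply/supB/IHd => //.
  suff lt_km: (vdeg k < vdeg m)%N by apply: leq_trans lt_km _; rewrite -ltnS.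
  rewrite /vdeg -(submK le_k) mdegD -[ltnLHS]add0n ltn_add2r lt0n mdeg_eq0.
  by apply/eqP => eq0; apply: ne_k; rewrite -(submK le_k) eq0 add0m.
have [a a_u a0] := varI_fill nVu.
pose u0 := mfilter (fun k => fill V 0 k == 0%MM) u.
pose f0 := mfilter (fun k => fill V 0 k == fill V 0 m) f.
have nz_u0 : u0 != 0.
  apply/eqP => /(congr1 (mcoeff a)); rewrite mcoeff_filter /= a0 eqxx mcoeff0.
  by apply/eqP; rewrite -mcoeff_msupp.
have nz_f0 : f0 != 0.
  apply/eqP => /(congr1 (mcoeff m)); rewrite mcoeff_filter /= eqxx mcoeff0.
  by apply/eqP; rewrite -mcoeff_msupp.
pose k := (mlead u0 + mlead f0)%MM.
have u0P b : b \in msupp u0 -> fill V 0 b = 0%MM.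
  by rewrite mcoeff_msupp mcoeff_filter /=; case: ifP => [/eqP //|_]; rewrite eqxx.
have f0P b : b \in msupp f0 -> fill V 0 b = fill V 0 m.
  by rewrite mcoeff_msupp mcoeff_filter /=; case: ifP => [/eqP //|_]; rewrite eqxx.
have kE : fill V 0 k = fill V 0 m.
  by rewrite fillD u0P ?f0P ?add0m ?mlead_supp.
suff k_uf : k \in msupp (u * f).
  apply: nBm; apply: (upB (fill V 0 m)); first by apply/mnm_lepP => i; rewrite fillE; case: ifP.
  by rewrite -kE; apply/supB/Iuf.
have -> : u * f = u0 * f0 + u0 * (f - f0) + (u - u0) * f.
  by rewrite -mulrDr mulrBl [f0 + _]addrC subrK addrC subrK.
have z1 : (u0 * (f - f0))@_k = 0.
  apply: memN_msupp_eq0; apply/negP => /msuppM_le/allpairsP[[b c] /= [b_u0 c_f kbc]].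
  move: c_f; rewrite mcoeff_msupp mcoeffB mcoeff_filter /=.
  have -> : fill V 0 c = fill V 0 m by rewrite -kE kbc fillD (u0P b) ?add0m.
  by rewrite eqxx subrr eqxx.
have z2 : ((u - u0) * f)@_k = 0.
  apply: memN_msupp_eq0; apply/negP => /msuppM_le/allpairsP[[b c] /= [b_u c_f kbc]].
  move: b_u; rewrite mcoeff_msupp mcoeffB mcoeff_filter /=.
  have cE : fill V 0 c = fill V 0 m.
    by apply: key => //; rewrite -kE kbc fillD; apply: lem_addl.
  have -> : fill V 0 b = 0%MM.
    by apply/eqP; rewrite -(eqm_add2r (fill V 0 c)) -fillD -kbc kE cE add0m.
  by rewrite eqxx subrr eqxx.
rewrite mcoeff_msupp !mcoeffD z1 z2 !addr0 mleadcM.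
by rewrite mulf_neq0 ?mleadc_eq0.
Qed.

Lemma vars_up V : upclosed (fun m => exists2 i, i \in V & m i != 0%N).
Proof.
move=> m m' /mnm_lepP mm' [i iV mi]; exists i => //.
by rewrite -lt0n; apply: leq_trans (mm' i); rewrite lt0n.
Qed.

(** Primality is saturation of [varI V] with respect to its own complement. *)
Lemma varI_prime V : is_prime_ideal (varI V).
Proof.
split=> [|V1|f g Vfg].
- exact/monI_ideal/vars_up.
- by have [|i _] := V1 0%MM; rewrite ?msupp1 ?mem_head // mnm0E.
have [|nVf] := classic (varI V f); [by left | right].
apply: monI_sat nVf Vfg; first exact: vars_up.
by move=> m [i iV mi]; exists i => //; rewrite fillE iV.
Qed.

Lemma varI_sub V (P : {mpoly K[s]} -> Prop) :
  is_ideal P -> (forall i, i \in V -> P 'X_i) -> ideal_sub (varI V) P.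
Proof.
move=> idP PV f Vf; apply: monI_terms => // m /Vf[i iV mi].
have /submK <- : (U_(i) <= m)%MM by rewrite lep1mP.
by rewrite mpolyXD; case: idP => _ _; apply; apply: PV.
Qed.

Lemma varIX V i : varI V 'X_i <-> i \in V.
Proof.
split=> [/monIX[j jV]|iV]; first by rewrite mnm1E; have [->|] := eqVneq i j.
by apply/monIX; exists i; rewrite // mnm1E eqxx.
Qed.

Lemma varI_inj V C : varI V = varI C -> V = C.
Proof. by move=> eqVC; apply/setP => i; apply/idP/idP => /varIX ?; apply/varIX; rewrite ?eqVC // -eqVC. Qed.

(** Contracting the localization of [monI A] at [varI C] is again a monomial ideal,
    obtained by giving the variables outside [C] the largest relevant exponent. *)
Lemma monI_locP N A C f : upclosed A -> bounded N A ->
  (exists2 u, ~ varI C u & monI A (u * f)) <-> monI (fun m => A (fill C N m)) f.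
Proof.
move=> upA bA; split=> [[u nCu Auf]|If].
  apply: (monI_sat (V := C) _ _ nCu).
  - move=> m m' /mnm_lepP mm'; apply: upA; apply/mnm_lepP => i.
    by rewrite !fillE; case: ifP.
  - move=> m; apply: upA; apply/mnm_lepP => i; rewrite !fillE.
    by case: ifP.
  move=> m /Auf /bA; apply: upA; apply/mnm_lepP => i.
  by rewrite capE fillE; case: ifP => _; rewrite ?geq_minl ?geq_minr.
exists 'X_[fill C N 0%MM].
  by case/monIX => i iC; rewrite fillE iC mnm0E.
rewrite mulrC => m; rewrite (perm_mem (msuppMX _ _)) => /mapP[k k_f ->].
apply: upA (If _ k_f); apply/mnm_lepP => i; rewrite mnmDE !fillE mnm0E.
by case: ifP; rewrite ?leq_addr ?leq_addl.
Qed.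

(** A largest exponent [c] outside [A] with entries at most [N] has a prime colon
    ideal: raising an entry below [N] enters [A] by maximality, whereas raising an
    entry equal to [N] never does because [A] is bounded by [N].  This replaces the
    Noetherian argument for the existence of associated primes. *)
Lemma Ass_exists N A m : upclosed A -> bounded N A -> ~ A m ->
  exists c, [/\ (cap N m <= c)%MM, forall i, (c i <= N)%N, ~ A c
             & Ass (monI A) (varI [set i | (c i < N)%N])].
Proof.
move=> upA bA nAm.
suff: exists c, [/\ (cap N m <= c)%MM, forall i, (c i <= N)%N, ~ A c
             & forall i, (c i < N)%N -> A (c + U_(i))%MM].
  move=> [c [mc cN nAc maxc]]; exists c; split=> //; split; first exact: varI_prime.
  exists 'X_[c] => f; split=> [Vf k | Jf k k_f].
    rewrite (perm_mem (msuppMX _ _)) => /mapP[a /Vf[i]]; rewrite inE => ciN ai ->.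
    apply: upA (maxc i ciN); apply/mnm_lepP => j; rewrite !mnmDE mnm1E leq_add2l.
    by case: eqP => // <-; rewrite lt0n.
  have Ack : A (c + k)%MM by apply: Jf; rewrite (perm_mem (msuppMX _ _)) map_f.
  apply: NNPP => noi; apply: nAc; apply: upA (bA _ Ack); apply/mnm_lepP => i.
  rewrite capE mnmDE; have [ciN|] := ltnP (c i) N; last by move=> ?; lia.
  have -> : k i = 0%N; last by lia.
  by apply/eqP/negPn/negP => ki; apply: noi; exists i; rewrite ?inE.
pose gap (c : 'X_{1..s}) := (\sum_(i < s) (N - c i))%N.
suff: forall d c, (gap c < d)%N -> (cap N m <= c)%MM -> (forall i, (c i <= N)%N) -> ~ A c ->
    exists c, [/\ (cap N m <= c)%MM, forall i, (c i <= N)%N, ~ A c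
             & forall i, (c i < N)%N -> A (c + U_(i))%MM].
  move/(_ _ (cap N m) (ltnSn _)); apply; first exact: lepm_refl.
    by move=> i; rewrite capE geq_minr.
  move=> Acap; apply: nAm; apply: upA Acap; apply/mnm_lepP => i.
  by rewrite capE geq_minl.
elim=> [//|d IHd] c lt_d mc cN nAc.
have [[i [ciN nAi]]|nex] := classic (exists i, (c i < N)%N /\ ~ A (c + U_(i))%MM); last first.
  exists c; split=> // i ciN; apply: NNPP => nAi; apply: nex; by exists i.
apply: (IHd (c + U_(i))%MM) => //.
- suff: (gap (c + U_(i))%MM < gap c)%N by move/leq_trans; apply; rewrite -ltnS.
  rewrite /gap (bigD1 i) // [ltnRHS](bigD1 i) //= -addSn leq_add //.
    by rewrite mnmDE mnm1E eqxx; lia.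
  by apply: leq_sum => j ji; rewrite mnmDE; lia.
- by apply: lepm_trans mc _; apply: lem_addr.
by move=> j; rewrite mnmDE mnm1E; case: eqP => [<-|_] //; rewrite ?addn1 ?addn0.
Qed.

(** A prime ideal that contains a monomial contains one of its variables. *)
Lemma prime_hits A (P : {mpoly K[s]} -> Prop) : is_prime_ideal P ->
  ideal_sub (monI A) P -> exists2 C, ideal_sub (varI C) P & hits C A.
Proof.
move=> prP AP.
have [C PC] : exists C : {set 'I_s}, forall i, i \in C <-> P 'X_i.
  have pC i : exists b : bool, b <-> P 'X_i.
    by have [Pi|nPi] := classic (P 'X_i); [exists true | exists false].
  suff: forall r : seq 'I_s, exists C : {set 'I_s}, forall i, i \in r -> i \in C <-> P 'X_i.
    by move=> /(_ (enum 'I_s))[C CP]; exists C => i; apply: CP; rewrite mem_enum.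
  elim=> [|i r [C CP]]; first by exists set0.
  have [[] bP] := pC i.
    exists (i |: C) => j; rewrite !inE; case: eqP => [->|] //= _; exact: CP.
  exists (C :\ i) => j; rewrite !inE; case: eqP => [->|] //= _; exact: CP.
exists C; first by apply: varI_sub => [|i /PC //]; case: prP.
move=> m Am; have: P 'X_[m] by apply/AP/monIX.
rewrite mpolyXE_id => Pm; apply: NNPP => noi; case: (prP) => _ P1 PM.
have: forall r, P (\prod_(i <- r) 'X_i ^+ m i) -> exists2 i, P 'X_i & m i != 0%N.
  elim=> [|i r IHr]; first by rewrite big_nil.
  rewrite big_cons => /PM[|/IHr //]; have [->|mi] := eqVneq (m i) 0%N; first by rewrite expr0.
  by move/(prime_pow prP) => Pi; exists i.
by move=> /(_ _ Pm)[i /PC iC mi]; apply: noi; exists i.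
Qed.

Lemma Ass_sub (I P : {mpoly K[s]} -> Prop) : is_ideal I -> Ass I P -> ideal_sub I P.
Proof. by case=> _ _ IM [_ [f Pf]] g Ig; apply/Pf; rewrite /ideal_colon mulrC; apply: IM. Qed.

Lemma varI_hits V A : ideal_sub (monI A) (varI V) -> hits V A.
Proof. by move=> AV m Am; have /AV/monIX : monI A 'X_[m] by apply/monIX. Qed.

Lemma varI_subset V C : ideal_sub (varI V) (varI C) -> V \subset C.
Proof. by move=> VC; apply/subsetP => i /varIX /VC /varIX. Qed.

(** Start from the exponent that is large outside [C]: the associated prime that
    [Ass_exists] provides is generated by a subset of [C], and minimality of [C]
    makes this subset all of [C]. *)
Lemma minhits_Ass N A C : upclosed A -> bounded N A -> minhits C A -> Ass (monI A) (varI C).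
Proof.
move=> upA bA [hC minC].
have [|c [mc cN nAc assV]] := @Ass_exists N A (fill C N 0%MM) upA bA.
  by case/hC => i iC; rewrite fillE iC mnm0E.
suff <- : [set i | (c i < N)%N] = C by [].
apply: minC; last exact: varI_hits (Ass_sub (monI_ideal upA) assV).
apply/subsetP => i; rewrite inE; apply: contraTT => iC; rewrite -leqNgt.
by move/mnm_lepP: mc => /(_ i); rewrite capE fillE (negPf iC) minnn.
Qed.

Lemma minAss_monI N A P : upclosed A -> bounded N A ->
  minAss (monI A) P <-> exists2 C, minhits C A & P = varI C.
Proof.
move=> upA bA; have idA := monI_ideal upA; split.
  case=> assP minP; have [prP _] := assP.
  have [C CP hC] := prime_hits prP (Ass_sub idA assP).
  have [C' sC' mC'] := minhits_exists hC; exists C' => //.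
  apply/esym/ideal_eqP/minP; first exact: minhits_Ass upA bA mC'.
  move=> f C'f; apply: CP => k /C'f[i iC ki].
  by exists i => //; apply: (subsetP sC').
case=> C mC ->; split; first exact: minhits_Ass upA bA mC.
move=> Q assQ QC; have [prQ _] := assQ.
have [C' C'Q hC'] := prime_hits prQ (Ass_sub idA assQ).
have C'C : C' = C.
  by case: mC => _; apply=> //; apply: varI_subset => f /C'Q /QC.
by split=> [/QC //|]; rewrite -C'C; apply: C'Q.
Qed.

Lemma symbolic_monI N A n f : upclosed A -> bounded N A ->
  symbolic_power (monI A) n f <->
  monI (fun m => forall C, minhits C A -> sumset A n (fill C (n * N) m)) f.
Proof.
move=> upA bA; have upS := @sumset_up s A n upA; have bS := @sumset_bounded s N A n upA bA.
have idS := monI_ideal upS.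
rewrite /symbolic_power monI_pow //; split=> [Sf m m_f C mC | If P].
  have /Sf : minAss (monI A) (varI C) by apply/(minAss_monI _ upA bA); exists C.
  by move/(loc_extP _ (varI_prime C) idS)/(monI_locP _ _ upS bS); apply.
case/(minAss_monI _ upA bA) => C mC ->.
apply/(loc_extP _ (varI_prime C) idS)/(monI_locP _ _ upS bS) => m /If; exact.
Qed.

Lemma pow_symbolicP N A n : upclosed A -> bounded N A ->
  ideal_eq (ideal_pow (monI A) n) (symbolic_power (monI A) n) <->
  forall m, (forall C, minhits C A -> sumset A n (fill C (n * N) m)) -> sumset A n m.
Proof.
move=> upA bA; split=> [eqS m Sm | SA f].
  apply/monIX; rewrite -monI_pow //; apply/eqS.
  by apply/(symbolic_monI _ _ upA bA)/monIX.
rewrite monI_pow //; apply: iff_trans (iff_sym (symbolic_monI n f upA bA)).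
split=> If m /If; last exact: SA.
move=> Am C _; apply: sumset_up (sumset_bounded upA bA Am) => //.
by apply/mnm_lepP => i; rewrite capE fillE; case: ifP; rewrite ?geq_minl ?geq_minr.
Qed.

(** A largest exponent [c] outside the sumset that dominates the truncation of [m]
    has an associated prime [varI V] as colon ideal.  If [V] is minimal, then the
    assumption on [m] applies to [V], and [c] dominates [m] raised outside [V],
    which would put [c] into the sumset. *)
Lemma Ass_pow_symbolic N A n :
  upclosed A -> bounded N A ->
  (forall V, Ass (ideal_pow (monI A) n) (varI V) -> minhits V A) ->
  ideal_eq (ideal_pow (monI A) n) (symbolic_power (monI A) n).
Proof.
move=> upA bA assA; apply/(pow_symbolicP _ upA bA) => m Sm; apply: NNPP => nSm.
have [c [/mnm_lepP mc cN nSc assV]] :=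
  @Ass_exists _ _ m (sumset_up upA) (sumset_bounded upA bA) nSm.
rewrite -monI_pow // in assV.
apply: nSc; apply: sumset_up (Sm _ (assA _ assV)) => //.
apply/mnm_lepP => i; have := mc i; have := cN i; rewrite capE fillE inE.
by case: ltnP; move: (n * N)%N => q; clear; lia.
Qed.

(** If [monI A] is the intersection of finitely many primary ideals [monI (B x)] with
    radicals [varI (V x)], then its associated primes are among these radicals: a
    prime colon ideal of a finite intersection is the colon ideal of one of the
    members. *)
Lemma Ass_cap (T : finType) (D : pred T) (V : T -> {set 'I_s}) (B : T -> 'X_{1..s} -> Prop) A P :
  (forall m, A m <-> forall x, D x -> B x m) ->
  (forall x, D x -> [/\ upclosed (B x), supported (V x) (B x)
     & forall i, i \in V x -> exists N, B x (U_(i) *+ N)%MM]) ->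
  Ass (monI A) P -> exists2 x, D x & P = varI (V x).
Proof.
move=> AB BV [prP [f Pf]]; have [idP P1 PM] := prP.
have [g0 ID IM] := idP.
have [x Dx xP] : exists2 x, D x & forall g, monI (B x) (g * f) -> P g.
  apply: NNPP => none.
  have: forall r : seq T, exists2 g, ~ P g & forall x, x \in r -> D x -> monI (B x) (g * f).
    elim=> [|x r [g nPg rg]]; first by exists 1.
    have [Dx|nDx] := boolP (D x); last first.
      exists g => // y; rewrite inE => /predU1P[->|/rg //]; by rewrite (negPf nDx).
    have [h nPh xh] : exists2 h, ~ P h & monI (B x) (h * f).
      apply: NNPP => noh; apply: none; exists x => // h xh; apply: NNPP => nPh.
      by apply: noh; exists h.
    exists (g * h) => [/PM[]//|y]; rewrite inE => yr Dy.
    have [upB _ _] := BV y Dy; have [_ _ BM] := monI_ideal upB.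
    move: yr => /predU1P[->|/rg /(_ Dy) yg].
      by rewrite -mulrA; case: (BV x Dx) => /monI_ideal[_ _] + _ _; apply.
    by rewrite [g * h]mulrC -mulrA; apply: BM.
  move=> /(_ (enum T))[g nPg rg]; apply: nPg; apply/Pf => m m_gf; apply/AB => x Dx.
  by apply: rg m_gf; rewrite ?mem_enum.
exists x => //; have [upB supB powB] := BV x Dx.
apply: ideal_eqP => g; split=> [Pg|].
  apply: NNPP => nVg; apply: P1; apply: xP; rewrite mul1r.
  by apply: monI_sat nVg _ => // m; move/Pf: Pg => /[apply] /AB; apply.
apply: varI_sub => // i /powB[N BN]; apply: (prime_pow (n := N)) => //; apply: xP.
have [_ _ BM] := monI_ideal upB.
by rewrite mulrC mpolyXn; apply: BM; apply/monIX.
Qed.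

End MonomialIdeals.

(** * Exponents of weighted edges and weighted covers *)

Lemma leq_divnD d p q : p %/ d + q %/ d <= (p + q) %/ d.
Proof.
by case: d => [|d]; rewrite ?divn0 // divnD // leq_addr.
Qed.

Lemma divn_subS d m : 0 < d -> d <= m -> m %/ d = ((m - d) %/ d).+1.
Proof. by move=> d0 dm; rewrite -{1}(subnKC dm) -[X in (X + _) %/ _]mul1n divnMDl. Qed.

Section EdgeCover.
Variables (s : nat) (D : wograph s).
Notation w := (weight D).
Implicit Types (C : {set 'I_s}) (m : 'X_{1..s}).

(** Any common bound of the weights would do. *)
Definition wmax := \sum_i w i.

Lemma weight_max i : w i <= wmax.
Proof. by rewrite /wmax (bigD1 i) //= leq_addr. Qed.

Lemma arc_neq i j : arc D i j -> i != j.
Proof. by move=> ij; apply/eqP => eij; move: (ij) (arc_asym ij); rewrite eij => ->. Qed.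

Definition edge_exp i j : 'X_{1..s} := (U_(i) + U_(j) *+ w j)%MM.

Lemma edge_expE i j x : edge_exp i j x = (i == x) + (j == x) * w j.
Proof. by rewrite mnmDE mulmnE !mnm1E. Qed.

(** The exponents of the edge ideal. *)
Definition edgeset m : Prop := exists2 p, arc D p.1 p.2 & (edge_exp p.1 p.2 <= m)%MM.

(** The exponents of the dual ideal. *)
Definition coverset m : Prop := forall i j, arc D i j -> (0 < m i) || (w j <= m j).

Lemma edgeset_up : upclosed edgeset.
Proof. by move=> m m' mm' [p Dp pm]; exists p => //; apply: lepm_trans mm'. Qed.

Lemma coverset_up : upclosed coverset.
Proof.
move=> m m' /mnm_lepP mm' cov i j /cov/orP[mi|mj]; apply/orP; [left | right].
  exact: leq_trans (mm' i).
exact: leq_trans (mm' j).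
Qed.

Lemma edgeset_bounded : bounded wmax edgeset.
Proof.
move=> m [p Dp /mnm_lepP pm]; exists p => //; apply/mnm_lepP => x.
rewrite capE leq_min pm /= edge_expE.
have := weight_max x; have := weight_gt0 D x; have := arc_neq Dp.
by case: (p.1 =P x) => [->|_]; case: (p.2 =P x) => [->|_] //=; rewrite ?eqxx //; lia.
Qed.

Lemma coverset_bounded : bounded wmax coverset.
Proof.
move=> m cov i j Dij; have := cov i j Dij.
by rewrite !capE; have := weight_max j; have := weight_max i; have := weight_gt0 D i; lia.
Qed.

Lemma coversetP m : coverset m <-> forall i j, arc D i j -> 1 <= m i + m j %/ w j.
Proof.
by split=> cov i j Dij; have := cov i j Dij;
  rewrite -(divn_gt0 (m j) (weight_gt0 D j)) addn_gt0.
Qed.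

Lemma hits_edgeset C : hits C edgeset <-> forall i j, arc D i j -> (i \in C) || (j \in C).
Proof.
split=> [hC i j Dij | covC m [p Dp /mnm_lepP pm]].
  have [|x xC] := hC (edge_exp i j); first by exists (i, j); rewrite ?lepm_refl.
  rewrite edge_expE; have [->|_] := eqVneq i x; first by rewrite xC.
  by have [->|_] := eqVneq j x; rewrite ?xC ?orbT.
have /orP[] := covC _ _ Dp => pC; [exists p.1 | exists p.2] => //; rewrite -lt0n.
  by apply: leq_trans (pm _); rewrite edge_expE eqxx.
apply: leq_trans (pm _); rewrite edge_expE eqxx.
by have := weight_gt0 D p.2; lia.
Qed.

Lemma minhits_coverset C : minhits C coverset ->
  exists i j, arc D i j /\ C = [set i; j].
Proof.
case=> hC minC.
have [i [j [Dij iC jC]]] : exists i j, [/\ arc D i j, i \in C & j \in C].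
  apply: NNPP => none.
  have [|x xC] := hC (fill C wmax 0%MM); last by rewrite fillE xC mnm0E.
  move=> i j Dij; rewrite !fillE !mnm0E; have := weight_max j; have := weight_max i.
  have := weight_gt0 D i; case: ifP => iC; case: ifP => jC; try lia.
  by case: none; exists i, j.
exists i, j; split=> //; apply/esym/minC.
  by apply/subsetP => x; rewrite !inE => /orP[]/eqP->.
move=> m cov; have /orP[mi|mj] := cov _ _ Dij.
  by exists i; rewrite ?set21 // -lt0n.
by exists j; rewrite ?set22 // -lt0n; apply: leq_trans mj; apply: weight_gt0.
Qed.

Lemma arc_minhits i j : arc D i j -> minhits [set i; j] coverset.
Proof.
move=> Dij; have hij : hits [set i; j] coverset.
  move=> m cov; have /orP[mi|mj] := cov _ _ Dij.
    by exists i; rewrite ?set21 // -lt0n.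
  by exists j; rewrite ?set22 // -lt0n; apply: leq_trans mj; apply: weight_gt0.
split=> // C sC hC.
have [C' sC' mC'] := minhits_exists hC.
have [k [l [Dkl CE]]] := minhits_coverset mC'.
apply/eqP; rewrite eqEcard sC /= (leq_trans _ (subset_leq_card sC')) //.
by rewrite CE !cards2 !arc_neq.
Qed.

(** * Sums of weighted covers *)

Lemma sumset_cover_le n m i j :
  sumset coverset n m -> arc D i j -> n <= m i + m j %/ w j.
Proof.
move=> + Dij; elim: n m => [//|n IHn] m [a [b [/coversetP/(_ _ _ Dij) ca /IHn cb ->]]].
by rewrite !mnmDE; have := leq_divnD (w j) (a j) (b j); lia.
Qed.

(** A converse of [sumset_cover_le] for a single arc: every other arc has an end
    outside [{i, j}], where the entries are large.  Each unit of [m i] and each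
    block of [w j] units of [m j] covers the arc once. *)
Lemma sumset_cover_local n m i j : arc D i j ->
  n <= m i + m j %/ w j -> sumset coverset n (fill [set i; j] (n * wmax) m).
Proof.
move=> Dij; elim: n m => [//|n IHn] m le_n.
have nij := arc_neq Dij; have asym_ij := arc_asym Dij.
have coverI (a : 'X_{1..s}) : (0 < a i) || (w j <= a j) -> coverset (fill [set i; j] wmax a).
  move=> aij x y Dxy; rewrite !fillE !inE.
  have [xij|_] := boolP ((x == i) || (x == j)); last first.
    by rewrite (leq_trans (weight_gt0 D x)) ?weight_max.
  have [yij|_] := boolP ((y == i) || (y == j)); last by rewrite weight_max orbT.
  case/orP: xij yij Dxy => /eqP-> /orP[]/eqP-> Dxy //; last by move: (arc_neq Dxy); rewrite eqxx.
    by move: (arc_neq Dxy); rewrite eqxx.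
  by move: asym_ij; rewrite Dxy.
have step (a b : 'X_{1..s}) : (0 < a i) || (w j <= a j) -> n <= b i + b j %/ w j ->
    a i + b i <= m i -> a j + b j <= m j ->
    sumset coverset n.+1 (fill [set i; j] (n.+1 * wmax) m).
  move=> /coverI ca /IHn cb mi mj; apply: (sumset_add coverset_up ca cb).
  apply/mnm_lepP => x; rewrite mnmDE !fillE !inE.
  by case: eqP => [->|_] //=; case: eqP => [->|_] //=; lia.
have [mi|mi] := posnP (m i).
  have mj : w j <= m j by rewrite -divn_gt0 ?weight_gt0; lia.
  apply: (step (U_(j) *+ w j)%MM (m - U_(j) *+ w j)%MM);
    rewrite ?mnmBE !mulmnE !mnm1E ?eqxx ?[j == i]eq_sym ?(negPf nij) /=; try lia.
  by move: le_n; rewrite (divn_subS (weight_gt0 D j) mj) ?mul1n; lia.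
apply: (step U_(i)%MM (m - U_(i))%MM);
  rewrite ?mnmBE !mnm1E ?eqxx ?(negPf nij) /= ?subn0; lia.
Qed.

(** The exponents of the [n]-th symbolic power of the dual ideal are those of its
    [n]-th power. *)
Definition cover_pow n : Prop := forall m,
  (forall i j, arc D i j -> n <= m i + m j %/ w j) -> sumset coverset n m.

Lemma heavy_in_arc j : (forall i, is_source D i -> w i = 1) -> 1 < w j ->
  exists i, arc D i j.
Proof.
move=> src wj; apply: NNPP => none; suff wj1 : w j = 1 by rewrite wj1 in wj.
by apply: src => i; apply/negP => Dij; apply: none; exists i.
Qed.

(** Let [m] have the entries [1] at [i] and [w j] at [j], and large entries outside
    [{i, j, k}].  In a sum of two weighted covers below [m], one summand is zero at
    [i], thus takes all of the entry at [j], and the other one must have at least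
    [w k] at [k].  The entry [c] at [k] is large enough for [m] to satisfy the
    inequalities of the arcs between [i] and [k], but too small to leave to the first
    summand what these arcs, or the entry itself, require. *)
Lemma cover_no_through i j k : cover_pow 2 -> arc D i j -> arc D j k -> 1 < w j ->
  (arc D k i -> w i = 1 \/ 1 < w k) -> False.
Proof.
move=> pow2 Dij Djk wj wik.
have [nij njk] := (arc_neq Dij, arc_neq Djk).
have nik : i != k by apply/eqP => eik; have := arc_asym Dij; rewrite eik Djk.
have [[w0i w0j] w0k] := (weight_gt0 D i, weight_gt0 D j, weight_gt0 D k).
pose c := if arc D i k then w k else if arc D k i then (if w i == 1 then 1 else 2) else 0.
pose m := [multinom if x == i then 1 else if x == j then w j else if x == k then c
                    else 2 * wmax | x < s].
have mi : m i = 1 by rewrite mnmE eqxx.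
have mj : m j = w j by rewrite mnmE eq_sym (negPf nij) eqxx.
have mk : m k = c by rewrite mnmE eq_sym (negPf nik) eq_sym (negPf njk) eqxx.
have big x : x \notin [:: i; j; k] -> m x = 2 * wmax.
  by rewrite !inE !negb_or mnmE => /and3P[/negPf-> /negPf-> /negPf->].
have [|a [b [ca cb /mnm_lepP abm]]] := @sumset_split2 _ coverset m.
  apply: pow2 => x y Dxy; have [xin|/big ->] := boolP (x \in [:: i; j; k]); last first.
    by apply: leq_trans (leq_addr _ _); have := weight_max x; have := weight_gt0 D x; lia.
  have [yin|/big ->] := boolP (y \in [:: i; j; k]); last first.
    by apply: leq_trans (leq_addl _ _); rewrite leq_divRL ?weight_gt0 // leq_mul2l weight_max.
  have := arc_neq Dxy; have := arc_asym Dxy.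
  move: xin yin Dxy; rewrite !inE => /or3P[]/eqP-> /or3P[]/eqP-> Dxy; rewrite ?eqxx // ?Dij ?Djk // => nDyx _.
  - by rewrite mi mj divnn w0j.
  - by rewrite mi mk /c Dxy divnn w0k.
  - by rewrite mj (leq_trans wj) ?leq_addr.
  - rewrite mk mi /c Dxy (negPf nDyx); case: eqP => [->|_] //; lia.
have key (d e : 'X_{1..s}) : coverset d -> coverset e ->
    (forall x, (d + e)%MM x <= m x) -> d i = 0 -> False.
  move=> cd ce dem di.
  have dj : w j <= d j by have := cd _ _ Dij; rewrite di.
  have ej : e j = 0 by have := dem j; rewrite mnmDE mj; lia.
  have ek : w k <= e k by have := ce _ _ Djk; rewrite ej.
  have := dem k; rewrite mnmDE mk /c.
  have [Dik|nDik] := boolP (arc D i k).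
    by have := cd _ _ Dik; rewrite di; lia.
  have [Dki|nDki] := boolP (arc D k i); last lia.
  by have := cd _ _ Dki; rewrite di; case: (wik Dki) => [->|]; case: eqP; lia.
have := abm i; rewrite mnmDE mi => ab_i.
have [ai|bi] : a i = 0 \/ b i = 0 by lia.
  exact: key ca cb abm ai.
by apply: key cb ca _ bi => x; rewrite addmC.
Qed.

(** Some arc enters a heavy vertex [j], as it is not a source.  The only case that
    [cover_no_through] does not settle is a directed triangle in which [i] is heavy
    and [k] is not; then it applies to the path from [k] through [i] to [j]. *)
Lemma cover_sinks : cover_pow 2 -> (forall i, is_source D i -> w i = 1) ->
  forall j, in_Vplus D j -> is_sink D j.
Proof.
move=> pow2 src j wj k; apply/negP => Djk.
have [i Dij] := heavy_in_arc src wj.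
have [wk|wk] := ltnP 1 (w k); first by apply: (cover_no_through pow2 Dij Djk wj); right.
have [wi|wi] := ltnP 1 (w i).
  have [Dki|nDki] := boolP (arc D k i); last first.
    by apply: (cover_no_through pow2 Dij Djk wj) => Dki; rewrite Dki in nDki.
  by apply: (cover_no_through pow2 Dki Dij wi); right.
by apply: (cover_no_through pow2 Dij Djk wj); left; have := weight_gt0 D i; lia.
Qed.

Definition tails_light : Prop := forall i j, arc D i j -> w i = 1.

Lemma sinks_light : (forall j, in_Vplus D j -> is_sink D j) -> tails_light.
Proof.
move=> sinks i j Dij; apply/eqP; rewrite eqn_leq weight_gt0 andbT leqNgt.
by apply/negP => /sinks/(_ j); rewrite Dij.
Qed.

(** In a decomposition of the weight vector into two weighted covers, each arc has
    exactly one end at which the first summand takes the whole weight.  Such vertices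
    form a colour class. *)
Lemma cover_bipartite : cover_pow 2 -> tails_light -> bipartite (underlying D).
Proof.
move=> pow2 light.
have [|a [b [ca cb /mnm_lepP abm]]] := @sumset_split2 _ coverset [multinom w x | x < s].
  apply: pow2 => i j Dij; rewrite !mnmE divnn weight_gt0; have := weight_gt0 D i; lia.
have {}abm x : a x + b x <= w x by have := abm x; rewrite mnmDE mnmE.
have diff x y : arc D x y -> (w x <= a x) != (w y <= a y).
  move=> Dxy; have wx := light _ _ Dxy; have := weight_gt0 D y.
  move: (ca _ _ Dxy) (cb _ _ Dxy) (abm x) (abm y); rewrite wx.
  by case: (leqP 1 (a x)); case: (leqP (w y) (a y)) => //=; lia.
by exists (fun x => w x <= a x) => x y /orP[/diff //|/diff]; rewrite eq_sym.
Qed.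

(** With [h x = m x %/ w x], the first cover consists of the vertices of one class
    with [h x >= 1] and those of the other class with [h x >= n.+1].  An arc covered
    at both ends has [h]-sum at least [n.+2], so subtracting this cover lowers the
    bound of every arc by at most one. *)
Lemma bipartite_cover_pow n m : bipartite (underlying D) ->
  (forall i j, arc D i j -> n <= m i %/ w i + m j %/ w j) -> sumset coverset n m.
Proof.
case=> c col; elim: n m => [//|n IHn] m hm.
pose p x := if c x then 0 < m x %/ w x else n < m x %/ w x.
pose a := [multinom p x * w x | x < s].
have pm x : p x -> w x <= m x.
  by rewrite -divn_gt0 ?weight_gt0 // /p; case: ifP => // _; apply: leq_trans.
have split x : m x %/ w x = p x + (m - a)%MM x %/ w x.
  rewrite mnmBE mnmE; case px: (p x); last by rewrite mul0n subn0.
  by rewrite mul1n (divn_subS (weight_gt0 D x) (pm _ px)).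
have am : (a <= m)%MM.
  by apply/mnm_lepP => x; rewrite mnmE; case px: (p x); rewrite ?mul1n ?pm.
have pxy x y : arc D x y -> p x || p y /\ (p x -> p y -> n.+2 <= m x %/ w x + m y %/ w y).
  move=> Dxy; have := hm _ _ Dxy; have := col x y; rewrite /underlying Dxy => /(_ isT).
  by rewrite /p; case: (c x); case: (c y) => //= _; lia.
apply: (@sumset_add _ _ n a (m - a)%MM) => //; last by rewrite addmC submK ?lepm_refl.
- exact: coverset_up.
- move=> x y Dxy; rewrite !mnmE; have [/orP[->|->] _] := pxy _ _ Dxy.
    by rewrite mul1n weight_gt0.
  by rewrite mul1n leqnn orbT.
apply: IHn => x y Dxy; have := hm _ _ Dxy; have [_] := pxy _ _ Dxy.
rewrite !split; move: (_ %/ _) (_ %/ _) => q r.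
by case: (p x); case: (p y) => /= H; try have := H isT isT; lia.
Qed.

(** * Sums of edges *)

(** Otherwise [x] could be removed from the minimal cover [C]. *)
Lemma private_edge C x : minhits C edgeset -> x \in C ->
  exists i j, arc D i j /\ (i = x /\ j \notin C \/ j = x /\ i \notin C).
Proof.
case=> hC minC xC; apply: NNPP => none.
have covC := (hits_edgeset C).1 hC.
suff /minC : hits (C :\ x) edgeset.
  by rewrite subD1set => /(_ isT) eqC; move: xC; rewrite -eqC setD11.
apply/hits_edgeset => i j Dij; rewrite !inE.
have := covC _ _ Dij; have := arc_neq Dij.
have [ix|_] := eqVneq i x; have [jx|_] := eqVneq j x => //=; first by rewrite ix jx eqxx.
  move=> _ _; apply/negPn/negP => jC; apply: none; exists i, j; split=> //; by left.
rewrite orbF => _ _; apply/negPn/negP => iC; apply: none; exists i, j; split=> //; by right.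
Qed.

Definition wsum (xs : seq 'I_s) : 'X_{1..s} := [multinom count_mem x xs * w x | x < s].

(** Each entry of [xs] pays for the private edge of that vertex, whose other end is
    outside [C] and hence free. *)
Lemma edge_local C xs : minhits C edgeset -> all [pred x in C] xs ->
  sumset edgeset (size xs) (fill C (size xs * wmax) (wsum xs)).
Proof.
move=> mC; elim: xs => [//|x xs IHxs] /= /andP[xC /IHxs cxs].
have [i [j [Dij ij]]] := private_edge mC xC; have nij := arc_neq Dij.
apply: (@sumset_add _ _ _ (edge_exp i j) _ _ edgeset_up _ cxs).
  by exists (i, j); rewrite ?lepm_refl.
apply/mnm_lepP => y; rewrite mnmDE edge_expE !fillE !mnmE /=.
have := weight_max y; have := weight_gt0 D y.
case: ij => [[<- jC]|[<- iC]]; have [iy|_] := eqVneq i y; have [jy|_] := eqVneq j y;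
  case: ifP => yC; rewrite ?iy ?jy /=; try lia;
  by [move: nij; rewrite iy jy eqxx | rewrite jy yC in jC | rewrite iy yC in iC].
Qed.

(** The exponents of the [n]-th symbolic power of the edge ideal are those of its
    [n]-th power. *)
Definition edge_pow n : Prop := forall m,
  (forall C, minhits C edgeset -> sumset edgeset n (fill C (n * wmax) m)) ->
  sumset edgeset n m.

Section Path.
Variables i j k : 'I_s.
Hypotheses (Dij : arc D i j) (Djk : arc D j k) (wj : 1 < w j).

Definition path_exp : 'X_{1..s} := (U_(i) + U_(j) *+ w j + U_(k) *+ w k)%MM.

Lemma path_expE x : path_exp x = (i == x) + (j == x) * w j + (k == x) * w k.
Proof. by rewrite !mnmDE !mulmnE !mnm1E. Qed.

(** If [j] is not in the cover [C], then its neighbours are, and both arcs of the path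
    fit.  If [C] contains [j] but not [k], the second arc fits twice, as [w j >= 2].  If
    [C] contains both, their private edges fit. *)
Lemma path_exp_local C : minhits C edgeset ->
  sumset edgeset 2 (fill C (2 * wmax) path_exp).
Proof.
move=> mC; have covC := (hits_edgeset C).1 mC.1.
have Eij : edgeset (edge_exp i j) by exists (i, j); rewrite ?lepm_refl.
have Ejk : edgeset (edge_exp j k) by exists (j, k); rewrite ?lepm_refl.
have w0j := weight_gt0 D j.
have [jC|jC] := boolP (j \in C).
  have [kC|kC] := boolP (k \in C).
    have := @edge_local C [:: j; k] mC; rewrite /= jC kC => /(_ isT).
    apply: (@sumset_up _ edgeset 2 edgeset_up); apply/mnm_lepP => x.
    rewrite !fillE; case: ifP => // _; rewrite path_expE mnmE /=.
    by case: (j =P x) => [->|_]; case: (k =P x) => [->|_] /=; clear; lia.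
  apply: (sumset_pair edgeset_up Ejk Ejk); apply/mnm_lepP => x.
  rewrite mnmDE !fillE edge_expE path_expE; case: ifP => xC.
    have kx : k == x = false by apply: contraNF kC => /eqP->; rewrite xC.
    by rewrite kx; case: (j =P x) => [<-|_] /=; move: wj; clear; lia.
  have jx : j == x = false by apply: contraFF xC => /eqP<-.
  by rewrite jx; move: (weight_max k); case: (k == x) => /=; clear; lia.
apply: (sumset_pair edgeset_up Eij Ejk); apply/mnm_lepP => x.
rewrite mnmDE !fillE !edge_expE path_expE; case: ifP => xC.
  have jx : j == x = false by apply: contraNF jC => /eqP->.
  by rewrite jx; clear; lia.
have [iC kC] : i \in C /\ k \in C.
  by have := covC _ _ Dij; have := covC _ _ Djk; rewrite (negPf jC) orbF.
have ix : i == x = false by apply: contraFF xC => /eqP<-.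
have kx : k == x = false by apply: contraFF xC => /eqP<-.
by rewrite ix kx; move: w0j (weight_max j); case: (j == x) => /=; clear; lia.
Qed.

(** Only the arcs among [i], [j] and [k] can occur in a sum below [path_exp].  Any two of
    them share a vertex, where the sum exceeds the entry of [path_exp]. *)
Lemma path_exp_notin : ~ sumset edgeset 2 path_exp.
Proof.
case/sumset_split2 => a [b [[p Dp /mnm_lepP pa] [q Dq /mnm_lepP qb] /mnm_lepP abm]].
have [nij njk] := (arc_neq Dij, arc_neq Djk).
have nik : i != k by apply/eqP => eik; have := arc_asym Dij; rewrite eik Djk.
have [[w0i w0j] w0k] := (weight_gt0 D i, weight_gt0 D j, weight_gt0 D k).
have H x : edge_exp p.1 p.2 x + edge_exp q.1 q.2 x <= path_exp x.
  by apply: leq_trans (abm x); rewrite mnmDE leq_add.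
have inside r : arc D r.1 r.2 -> (forall x, edge_exp r.1 r.2 x <= path_exp x) ->
    [\/ r = (i, j), r = (j, k), r = (i, k) | r = (k, i)].
  move=> Dr rm.
  have vert x : 0 < edge_exp r.1 r.2 x -> [|| i == x, j == x | k == x].
    move=> rx; have := leq_trans rx (rm x); rewrite path_expE.
    by case: eqP => //= _; case: eqP => //= _; case: eqP.
  have v1 : 0 < edge_exp r.1 r.2 r.1 by rewrite edge_expE eqxx.
  have v2 : 0 < edge_exp r.1 r.2 r.2.
    by rewrite edge_expE eqxx mul1n addn_gt0 weight_gt0 orbT.
  move: Dr; rewrite (surjective_pairing r) /=.
  case/or3P: (vert _ v1) => /eqP <-; case/or3P: (vert _ v2) => /eqP <- Dr;
    by [move: (arc_neq Dr); rewrite eqxx | move: (arc_asym Dr); rewrite ?Dij ?Djk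
       | constructor 1 | constructor 2 | constructor 3 | constructor 4].
have pm x : edge_exp p.1 p.2 x <= path_exp x := leq_trans (leq_addr _ _) (H x).
have qm x : edge_exp q.1 q.2 x <= path_exp x := leq_trans (leq_addl _ _) (H x).
have neqs := (negPf nij, negPf njk, negPf nik).
have neqs' : ((j == i = false) * (k == j = false) * (k == i = false))%type.
  by rewrite ![_ == i]eq_sym [k == j]eq_sym !neqs.
move: (H i) (H j) (H k); rewrite !path_expE !eqxx !neqs !neqs' /=.
case: (inside p Dp pm) => ->; case: (inside q Dq qm) => -> /=;
  rewrite !edge_expE ?eqxx ?neqs ?neqs' /=; move: w0i w0j w0k wj; clear; lia.
Qed.

End Path.

Lemma edge_sinks : edge_pow 2 -> (forall i, is_source D i -> w i = 1) ->
  forall j, in_Vplus D j -> is_sink D j.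
Proof.
move=> pow2 src j wj k; apply/negP => Djk; have [i Dij] := heavy_in_arc src wj.
apply: (path_exp_notin Dij Djk wj); apply: pow2 => C; exact: path_exp_local.
Qed.

(** Each edge contributes to the sum at an end in [C]: a head enters with its weight,
    and a tail has weight one. *)
Lemma sumset_edge_ge C n m : tails_light -> (forall i j, arc D i j -> (i \in C) || (j \in C)) ->
  sumset edgeset n m -> n <= \sum_(x in C) m x %/ w x.
Proof.
move=> light covC; elim: n m => [//|n IHn] m [a [b [[p Dp /mnm_lepP pa] /IHn cb ->]]].
suff: 1 <= \sum_(x in C) a x %/ w x.
  move: cb => /leq_add /[apply]; rewrite addn1 -big_split /= => le_n.
  apply: leq_trans le_n _; apply: leq_sum => x _.
  by rewrite mnmDE addnC; apply: leq_divnD.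
have use x : x \in C -> w x <= a x -> 1 <= \sum_(x in C) a x %/ w x.
  by move=> xC wx; rewrite (bigD1 x) //= addn_gt0 divn_gt0 ?weight_gt0 ?wx.
have := covC _ _ Dp; case/orP => pC; apply: (use _ pC); apply: leq_trans (pa _).
  by rewrite edge_expE eqxx (light _ _ Dp).
by rewrite edge_expE eqxx mul1n leq_addl.
Qed.

(** Both ends of an edge contribute to the weighted degree. *)
Lemma sumset_edge_deg n m : tails_light -> sumset edgeset n m -> n.*2 <= \sum_x m x %/ w x.
Proof.
move=> light; elim: n m => [//|n IHn] m [a [b [[p Dp /mnm_lepP pa] /IHn cb ->]]].
suff: 2 <= \sum_x a x %/ w x.
  move: cb => /leq_add /[apply]; rewrite -big_split /= doubleS addn2 => le_n.
  apply: leq_trans le_n _; apply: leq_sum => x _.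
  by rewrite mnmDE addnC; apply: leq_divnD.
have np := arc_neq Dp.
rewrite (bigD1 p.1) //= (bigD1 p.2) 1?eq_sym //=.
have p1 : 0 < a p.1 %/ w p.1.
  rewrite divn_gt0 ?weight_gt0 // (light _ _ Dp).
  by apply: leq_trans (pa _); rewrite edge_expE eqxx.
have p2 : 0 < a p.2 %/ w p.2.
  by rewrite divn_gt0 ?weight_gt0 //; apply: leq_trans (pa _); rewrite edge_expE eqxx mul1n leq_addl.
lia.
Qed.

(** A closed walk of length [2k+1] has weighted degree [2k+1] and is therefore not a sum
    of [k+1] edges, but each minimal cover contains [k+1] of its vertices, whose private
    edges fit locally. *)
Lemma edge_bipartite : (forall n, edge_pow n.+1) -> tails_light -> bipartite (underlying D).
Proof.
move=> pow light.
have symu x y : underlying D x y = underlying D y x by rewrite /underlying orbC.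
apply: bipartite_no_odd_cycle => // x p xp lastp; apply/negP => oddp.
have szp : size p = (size p)./2.*2.+1 by rewrite -[LHS]odd_double_half oddp.
move: (size p)./2 szp => k szp.
have /(sumset_edge_deg light) : sumset edgeset k.+1 (wsum p).
  apply: pow => C mC; have covC := (hits_edgeset C).1 mC.1.
  pose xs := take k.+1 [seq y <- p | y \in C].
  have szxs : size xs = k.+1.
    rewrite size_takel // size_filter.
    have covu u v : underlying D u v -> (u \in C) || (v \in C).
      by case/orP => /covC //; rewrite orbC.
    have := cover_closed_walk covu xp lastp; rewrite szp.
    by move: (count _ _) => q; clear; lia.
  have xsC : all [pred x in C] xs by apply/allP => y /mem_take; rewrite mem_filter => /andP[].
  have := edge_local mC xsC; rewrite szxs; apply: (@sumset_up _ edgeset k.+1 edgeset_up).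
  apply/mnm_lepP => y; rewrite !fillE; case: ifP => // _; rewrite !mnmE leq_mul2r.
  apply/orP; right.
  apply: leq_trans (_ : count_mem y [seq y <- p | y \in C] <= _).
    by rewrite -[X in _ <= count_mem y X](cat_take_drop k.+1) count_cat leq_addr.
  by rewrite count_filter; apply: sub_count => z /andP[].
rewrite (eq_bigr (fun x => count_mem x p)) => [|y _]; last first.
  by rewrite mnmE mulnK ?weight_gt0.
suff -> : \sum_y count_mem y p = size p by rewrite szp; clear; lia.
elim: p {xp lastp oddp szp} => [|y p IHp] /=; first by rewrite big1.
rewrite big_split /= IHp (bigD1 y) //= eqxx big1 // => z; by rewrite eq_sym => /negPf->.
Qed.

(** The local conditions say that each cover has capacity at least [n] for the
    capacities [m x %/ w x]. *)
Lemma bipartite_edge_pow n m : bipartite (underlying D) -> tails_light ->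
  (forall C, minhits C edgeset -> sumset edgeset n (fill C (n * wmax) m)) ->
  sumset edgeset n m.
Proof.
case=> c col light Sm.
have [x y Dxy|C /vcoverP covC|E [<- eE mE]] :=
    @konig _ (arc D) c _ (fun x => m x %/ w x) n.
- by apply: col; rewrite /underlying Dxy.
- have /minhits_exists[C' sC' mC'] := (hits_edgeset C).2 covC.
  have := sumset_edge_ge light ((hits_edgeset C').1 mC'.1) (Sm C' mC').
  move/leq_trans; apply; rewrite (eq_bigr (fun x => m x %/ w x)) => [|x xC'].
    rewrite big_mkcond [leqRHS]big_mkcond; apply: leq_sum => x _.
    by case: ifP => // /(subsetP sC') ->.
  by rewrite fillE xC'.
pose t E := [multinom (\sum_(p <- E) ((p.1 == x) + (p.2 == x))) * w x | x < s].
have tm : (t E <= m)%MM.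
  by apply/mnm_lepP => x; rewrite mnmE -leq_divRL ?weight_gt0.
apply: (sumset_up edgeset_up tm); elim: E eE {mE tm} => [//|p E IHE] /= /andP[Dp /IHE tE].
apply: (@sumset_add _ _ _ (edge_exp p.1 p.2) _ _ edgeset_up _ tE).
  by exists p; rewrite ?lepm_refl.
apply/mnm_lepP => x; rewrite mnmDE edge_expE !mnmE big_cons !mulnDl.
by rewrite leq_add2r leq_add ?leq_pmulr ?weight_gt0 //; case: eqP => // ->.
Qed.

End EdgeCover.

(** * Edge ideals and dual ideals *)

Section GraphIdeals.
Variables (K : fieldType) (s : nat) (D : wograph s).
Local Open Scope ring_scope.

Lemma edge_idealE : edge_ideal K D = monI (edgeset D).
Proof.
rewrite -[RHS]monI_gen; congr ideal_gen; apply: ideal_eqP => f.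
split=> [[i [j [Dij ->]]]|[p Dp ->]].
  by exists (i, j); rewrite // mpolyXD mpolyXn.
by exists p.1, p.2; rewrite mpolyXD mpolyXn.
Qed.

Lemma dual_idealE : dual_ideal K D = monI (coverset D).
Proof.
have genE i j : ideal_gen (fun g : {mpoly K[s]} => g = 'X_i \/ g = 'X_j ^+ weight D j)
    = monI (fun m => (0 < m i)%N || (weight D j <= m j)%N).
  pose t (b : bool) : 'X_{1..s} := if b then U_(i)%MM else (U_(j) *+ weight D j)%MM.
  transitivity (monI (K := K) (fun m => exists2 b, True & (t b <= m)%MM)).
    rewrite -monI_gen; congr ideal_gen; apply: ideal_eqP => f.
    split=> [[->|->]|[[] _ ->]]; [by exists true | | by left | by right; rewrite mpolyXn].
    by exists false => //; rewrite mpolyXn.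
  congr monI; apply: functional_extensionality => m; apply: propositional_extensionality.
  split=> [[[] _ /=]|/orP[mi|mj]]; first by rewrite lep1mP lt0n => ->.
  - by move/mnm_lepP/(_ j); rewrite mulmnE mnm1E eqxx mul1n => ->; rewrite orbT.
  - by exists true; rewrite //= lep1mP -lt0n.
  exists false => //=; apply/mnm_lepP => x; rewrite mulmnE mnm1E.
  by case: eqP => [<-|_]; rewrite ?mul1n.
apply: ideal_eqP => f; rewrite /dual_ideal; split=> [Jf m m_f i j Dij | Jf i j Dij].
  by have := Jf i j Dij; rewrite genE; apply.
by rewrite genE => m m_f; apply: (Jf m m_f).
Qed.

Lemma dual_pow_symbolicP n :
  ideal_eq (ideal_pow (dual_ideal K D) n) (symbolic_power (dual_ideal K D) n)
  <-> cover_pow D n.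
Proof.
rewrite dual_idealE; apply: iff_trans (pow_symbolicP _ _ (@coverset_up _ D) (@coverset_bounded _ D)) _.
split=> H m Hm; apply: H.
  move=> C /minhits_coverset[i [j [Dij ->]]].
  exact: sumset_cover_local (Hm i j Dij).
move=> i j Dij; have := sumset_cover_le (Hm _ (arc_minhits Dij)) Dij.
by rewrite !fillE set21 set22.
Qed.

Lemma edge_pow_symbolicP n :
  ideal_eq (ideal_pow (edge_ideal K D) n) (symbolic_power (edge_ideal K D) n)
  <-> edge_pow D n.
Proof. rewrite edge_idealE; exact: pow_symbolicP (@edgeset_up _ D) (@edgeset_bounded _ D). Qed.

(** The power is the intersection of the ideals [(t_i, t_j^w_j)^n], whose exponents are
    given by [B] and whose radicals are [(t_i, t_j)]. *)
Lemma Ass_dual_pow n P : (0 < n)%N -> cover_pow D n ->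
  Ass (ideal_pow (dual_ideal K D) n) P -> exists i j, arc D i j /\ P = varI [set i; j].
Proof.
move=> n_gt0 pow_n; rewrite dual_idealE monI_pow; last exact: coverset_up.
pose B (p : 'I_s * 'I_s) (m : 'X_{1..s}) := (n <= m p.1 + m p.2 %/ weight D p.2)%N.
case/(@Ass_cap K s _ (fun p => arc D p.1 p.2) (fun p => [set p.1; p.2]) B).
- move=> m; split=> [Sm [i j] Dij | Bm]; first exact: sumset_cover_le Dij.
  by apply: pow_n => i j Dij; apply: (Bm (i, j)).
- move=> [i j] Dij; split=> [m m' /mnm_lepP mm'|m|x].
  + by move/leq_trans; apply; rewrite leq_add ?leq_div2r.
  + by rewrite /B !fillE set21 set22.
  rewrite !inE => /orP[]/eqP->.
    exists n; rewrite /B /= (leq_trans _ (leq_addr _ _)) //.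
    by rewrite mulmnE mnm1E eqxx mul1n.
  exists (n * weight D j)%N; rewrite /B /= (leq_trans _ (leq_addl _ _)) //.
  by rewrite mulmnE mnm1E eqxx mul1n mulnK ?weight_gt0.
by move=> [i j] Dij ->; exists i, j.
Qed.

Lemma cover_pow1 : cover_pow D 1.
Proof. by move=> m /coversetP cov; exists m, 0%MM; rewrite addm0. Qed.

End GraphIdeals.

Theorem corollary7p7 (K : fieldType) (s : nat) (D : wograph s)
  (hsource : forall i, is_source D i -> weight D i = 1%N)
  (hemb : forall P, ~ embedded_prime (edge_ideal K D) P) :
  let I := edge_ideal K D in
  let J := dual_ideal K D in
  [<-> (forall n, (1 <= n)%N -> forall P, Ass (ideal_pow J n) P -> Ass J P);
       (forall n, (1 <= n)%N -> ideal_eq (ideal_pow J n) (symbolic_power J n));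
       (forall n, (1 <= n)%N -> ideal_eq (ideal_pow I n) (symbolic_power I n));
       ((forall i, in_Vplus D i -> is_sink D i) /\ bipartite (underlying D))].
Proof.
move=> I J.
have J1 : ideal_pow J 1 = J.
  rewrite /J dual_idealE monI_pow; last exact: coverset_up.
  congr monI; apply: functional_extensionality => m; apply: propositional_extensionality.
  split=> [[a [b [ca _ ->]]]|cm]; first exact: coverset_up (lem_addr _ _) ca.
  by exists m, 0%MM; rewrite addm0.
tfae.
- move=> assJ n n_gt0; rewrite /J dual_idealE.
  apply: (Ass_pow_symbolic (@coverset_up _ D) (@coverset_bounded _ D)) => V.
  rewrite -dual_idealE -/J => /(assJ n n_gt0); rewrite -J1.
  case/(Ass_dual_pow _ (@cover_pow1 _ D)) => // i [j [Dij /varI_inj ->]].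
  exact: arc_minhits.
- move=> powJ; have pow2 := (dual_pow_symbolicP K D 2).1 (powJ 2 isT).
  have sinks := cover_sinks pow2 hsource; have light := sinks_light sinks.
  have bip := cover_bipartite pow2 light.
  move=> n n_gt0; apply/edge_pow_symbolicP => m; exact: bipartite_edge_pow.
- move=> powI; have pow n : edge_pow D n.+1 by apply/edge_pow_symbolicP/powI.
  have sinks := edge_sinks (pow 1%N) hsource.
  by split=> //; apply: edge_bipartite (sinks_light sinks).
move=> [sinks bip] n n_gt0 P.
have light := sinks_light sinks.
have pow_n : cover_pow D n.
  move=> m hm; apply: bipartite_cover_pow => // i j Dij.
  by rewrite (light _ _ Dij) divn1; apply: hm.
case/(Ass_dual_pow n_gt0 pow_n) => i [j [Dij ->]].
rewrite /J dual_idealE.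
exact: minhits_Ass (@coverset_up _ D) (@coverset_bounded _ D) (arc_minhits Dij).
Qed.
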